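(* Let $\phi = \frac{1+\sqrt5}{2}$, $d(n) = \lfloor n\phi^3\rfloor$ and $c(n) = \lfloor n\phi^2/2\rfloor$. For every $n \ge 1$, the fractional part $\{d(n)\phi\}$ lies in the interval $\big(\frac{3-\sqrt5}{2}, \frac12\big)$ if $\{n\phi\} > \frac12$, and in the interval $\big(\frac{4-\sqrt5}{2}, 1\big)$ if $\{n\phi\} < \frac12$. For every $n \ge 1$, $\{c(2n)\phi\}$ lies in $\big(0, \frac{3-\sqrt5}{2}\big)$, and $\{c(2n+1)\phi\}$ lies in $\big(\frac12, \frac{4-\sqrt5}{2}\big)$.
   Context: $\{x\} = x - \lfloor x \rfloor$ denotes the fractional part of a real number $x$. *)

(* Defs.v *)
From Stdlib Require Import Reals.
Local Open Scope R_scope.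

(* [Int_part] is the floor function, also for negative reals, and
   [frac_part x = x - IZR (Int_part x)]. *)

Definition phi : R := (1 + sqrt 5) / 2.

Definition d (n : nat) : Z := Int_part (INR n * phi ^ 3).

Definition c (n : nat) : Z := Int_part (INR n * phi ^ 2 / 2).

(* Main.v *)
(** With [m = floor (n phi)] and [f = n phi - m], the relation [phi^2 = phi + 1]
    expresses [d n], [c (2 n)] and [c (2 n + 1)] as integer combinations of [n],
    [m] and [1], and [m phi = n phi + n - f phi]. Hence the fractional part of the
    product by [phi] is an affine function of [f] on each of the ranges of [f]
    cut out by the floor, and the stated intervals are the images of these
    ranges. Irrationality of [phi] excludes the endpoints [f = 0] and
    [f = (3 - phi) / 2]. *)
Require Import Defs.
From Stdlib Require Import Reals ZArith Lia Lra.
Local Open Scope R_scope.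

Lemma phi_sqr : phi * phi = phi + 1.
Proof.
  unfold phi.
  assert (h : sqrt 5 * sqrt 5 = 5) by (apply sqrt_sqrt; lra).
  lra.
Qed.

Lemma sqrt5_phi : sqrt 5 = 2 * phi - 1.
Proof. unfold phi; lra. Qed.

Lemma phi_bounds : 1.6 < phi < 1.62.
Proof.
  assert (h := phi_sqr).
  assert (0 < phi) by (unfold phi; assert (h5 := sqrt_pos 5); lra).
  split; nra.
Qed.

(* Descent along the Euclidean step [(k, n) -> (n, k - n)]. *)
Lemma golden_form_anisotropic (n : Z) :
  (0 <= n -> forall k, 0 <= k -> k * k = k * n + n * n -> n = 0)%Z.
Proof.
  intros hn; revert n hn.
  apply (Zlt_0_ind (fun n => forall k, 0 <= k -> k * k = k * n + n * n -> n = 0)%Z).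
  intros n IH hn k hk h.
  destruct (Z.eq_dec n 0) as [|n0]; [assumption|exfalso].
  assert (n <= k)%Z by nia.
  assert (k - n < n)%Z by nia.
  assert (k - n = 0)%Z by (apply (IH (k - n)%Z) with (k := n); nia).
  nia.
Qed.

(** Squaring [n phi = k] and using [phi^2 = phi + 1] gives [k^2 = k n + n^2] in integers, hence
    [n = 0]. *)
Lemma phi_irrational (n k : Z) : (0 < n)%Z -> IZR n * phi <> IZR k.
Proof.
  intros hn h.
  assert (b := phi_bounds).
  assert (hn' : 0 < IZR n) by (apply IZR_lt; assumption).
  assert (hk : (0 <= k)%Z) by (apply le_IZR; nra).
  assert (e : (k * k = k * n + n * n)%Z).
  { apply eq_IZR; rewrite plus_IZR, !mult_IZR, <- h.
    replace (IZR n * phi * (IZR n * phi)) with (IZR n * IZR n * (phi * phi)) by ring.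
    rewrite phi_sqr; ring. }
  apply golden_form_anisotropic in e; lia.
Qed.

Lemma Int_part_eq (x : R) (z : Z) : IZR z <= x < IZR z + 1 -> Int_part x = z.
Proof. intros h; symmetry; apply Int_part_spec; lra. Qed.

Lemma frac_part_eq (x f : R) (z : Z) : x = IZR z + f -> 0 <= f < 1 -> frac_part x = f.
Proof.
  intros h hf; unfold frac_part.
  rewrite (Int_part_eq x z); lra.
Qed.

Lemma frac_part_phi_pos (n : nat) : (1 <= n)%nat -> 0 < frac_part (INR n * phi).
Proof.
  intros hn.
  destruct (base_fp (INR n * phi)) as [[h | h] _]; [lra | exfalso].
  unfold frac_part in h; rewrite INR_IZR_INZ in h.
  eapply (phi_irrational (Z.of_nat n)); [lia | apply Rminus_diag_uniq, h].
Qed.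

Lemma phi_mul_floor (n : nat) (f := frac_part (INR n * phi)) :
  IZR (Int_part (INR n * phi)) * phi = INR n * phi + INR n - f * phi.
Proof.
  replace (IZR (Int_part (INR n * phi))) with (INR n * phi - f)
    by (unfold f, frac_part; ring).
  replace ((INR n * phi - f) * phi) with (INR n * (phi * phi) - f * phi) by ring.
  rewrite phi_sqr; ring.
Qed.

Lemma n_phi_split (n : nat) :
  INR n * phi = IZR (Int_part (INR n * phi)) + frac_part (INR n * phi).
Proof. unfold frac_part; ring. Qed.

Lemma phi_cube : phi ^ 3 = 2 * phi + 1.
Proof.
  replace (phi ^ 3) with (phi * (phi * phi)) by ring.
  rewrite phi_sqr, Rmult_plus_distr_l, phi_sqr; ring.
Qed.

(** Since [n phi^3 = 2 m + n + 2 f], the floor gains a carry of 1 once [2 f] exceeds 1. *)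
Lemma frac_part_d_phi_high (n : nat) (f := frac_part (INR n * phi)) :
  1 / 2 < f -> frac_part (IZR (d n) * phi) = phi - 1 - f * (2 * phi - 3).
Proof.
  intros hf.
  assert (b := phi_bounds); assert (s := n_phi_split n).
  assert (p := phi_mul_floor n); assert (bf := base_fp (INR n * phi)).
  fold f in s, p, bf.
  set (m := Int_part (INR n * phi)) in *.
  assert (e : d n = (2 * m + 1 + Z.of_nat n)%Z).
  { apply Int_part_eq; rewrite phi_cube, !plus_IZR, mult_IZR, <- INR_IZR_INZ; lra. }
  (* [(2 m + n + 1) phi = 3 n phi + 2 n + phi - 2 f phi], where [3 n phi = 3 m + 3 f]. *)
  apply frac_part_eq with (z := (3 * m + 2 * Z.of_nat n + 1)%Z); [|nra].
  rewrite e, !plus_IZR, !mult_IZR, <- INR_IZR_INZ; lra.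
Qed.

(** Here [2 f < 1] gives no carry. At [f = 0] the formula would give 1, which is no fractional
    part. *)
Lemma frac_part_d_phi_low (n : nat) (f := frac_part (INR n * phi)) :
  0 < f < 1 / 2 -> frac_part (IZR (d n) * phi) = 1 - f * (2 * phi - 3).
Proof.
  intros hf.
  assert (b := phi_bounds); assert (s := n_phi_split n).
  assert (p := phi_mul_floor n).
  fold f in s, p.
  set (m := Int_part (INR n * phi)) in *.
  assert (e : d n = (2 * m + Z.of_nat n)%Z).
  { apply Int_part_eq; rewrite phi_cube, !plus_IZR, mult_IZR, <- INR_IZR_INZ; lra. }
  (* The remainder [- f (2 phi - 3)] is negative, so the integer part drops by one. *)
  apply frac_part_eq with (z := (3 * m + 2 * Z.of_nat n - 1)%Z); [|nra].
  rewrite e, !minus_IZR, !plus_IZR, !mult_IZR, <- INR_IZR_INZ; lra.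
Qed.

Lemma frac_part_c_even_phi (n : nat) (f := frac_part (INR n * phi)) :
  frac_part (IZR (c (2 * n)) * phi) = f * (2 - phi).
Proof.
  assert (b := phi_bounds); assert (s := n_phi_split n).
  assert (p := phi_mul_floor n); assert (bf := base_fp (INR n * phi)).
  fold f in s, p, bf.
  set (m := Int_part (INR n * phi)) in *.
  assert (e : c (2 * n) = (m + Z.of_nat n)%Z).
  { apply Int_part_eq.
    rewrite <- Rsqr_pow2; unfold Rsqr.
    rewrite phi_sqr, mult_INR, !plus_IZR, <- INR_IZR_INZ; simpl (INR 2); lra. }
  apply frac_part_eq with (z := (2 * m + Z.of_nat n)%Z); [|nra].
  rewrite e, !plus_IZR, !mult_IZR, <- INR_IZR_INZ; lra.
Qed.

(** [(2 n + 1) phi^2 / 2 = m + n + f + (phi + 1) / 2], and [f + (phi + 1) / 2] reaches 2 exactly at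
    [f = (3 - phi) / 2]. *)
Lemma frac_part_c_odd_phi_low (n : nat) (f := frac_part (INR n * phi)) :
  f < (3 - phi) / 2 ->
  frac_part (IZR (c (2 * n + 1)) * phi) = f * (2 - phi) + phi - 1.
Proof.
  intros hf.
  assert (b := phi_bounds); assert (s := n_phi_split n).
  assert (p := phi_mul_floor n); assert (bf := base_fp (INR n * phi)).
  fold f in s, p, bf.
  set (m := Int_part (INR n * phi)) in *.
  assert (e : c (2 * n + 1) = (m + Z.of_nat n + 1)%Z).
  { apply Int_part_eq.
    rewrite <- Rsqr_pow2; unfold Rsqr.
    rewrite phi_sqr, plus_INR, mult_INR, !plus_IZR, <- INR_IZR_INZ.
    simpl (INR 2); simpl (INR 1); lra. }
  apply frac_part_eq with (z := (2 * m + Z.of_nat n + 1)%Z); [|nra].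
  rewrite e, !plus_IZR, !mult_IZR, <- INR_IZR_INZ; lra.
Qed.

Lemma frac_part_c_odd_phi_high (n : nat) (f := frac_part (INR n * phi)) :
  (3 - phi) / 2 <= f ->
  frac_part (IZR (c (2 * n + 1)) * phi) = f * (2 - phi) + 2 * phi - 3.
Proof.
  intros hf.
  assert (b := phi_bounds); assert (s := n_phi_split n).
  assert (p := phi_mul_floor n); assert (bf := base_fp (INR n * phi)).
  fold f in s, p, bf.
  set (m := Int_part (INR n * phi)) in *.
  assert (e : c (2 * n + 1) = (m + Z.of_nat n + 2)%Z).
  { apply Int_part_eq.
    rewrite <- Rsqr_pow2; unfold Rsqr.
    rewrite phi_sqr, plus_INR, mult_INR, !plus_IZR, <- INR_IZR_INZ.
    simpl (INR 2); simpl (INR 1); lra. }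
  apply frac_part_eq with (z := (2 * m + Z.of_nat n + 3)%Z); [|nra].
  rewrite e, !plus_IZR, !mult_IZR, <- INR_IZR_INZ; lra.
Qed.

(** Equality would give [(2 n + 1) phi = 2 m + 3], against irrationality. *)
Lemma frac_part_phi_neq (n : nat) : frac_part (INR n * phi) <> (3 - phi) / 2.
Proof.
  intros h; assert (s := n_phi_split n); rewrite h in s.
  apply (phi_irrational (2 * Z.of_nat n + 1)
           (2 * Int_part (INR n * phi) + 3)); [lia|].
  rewrite !plus_IZR, !mult_IZR, <- INR_IZR_INZ; lra.
Qed.

Theorem theorem3p6 :
  (forall n : nat, (1 <= n)%nat ->
     (frac_part (INR n * phi) > 1 / 2 ->
        (3 - sqrt 5) / 2 < frac_part (IZR (d n) * phi) < 1 / 2) /\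
     (frac_part (INR n * phi) < 1 / 2 ->
        (4 - sqrt 5) / 2 < frac_part (IZR (d n) * phi) < 1)) /\
  (forall n : nat, (1 <= n)%nat ->
     0 < frac_part (IZR (c (2 * n)) * phi) < (3 - sqrt 5) / 2 /\
     1 / 2 < frac_part (IZR (c (2 * n + 1)) * phi) < (4 - sqrt 5) / 2).
Proof.
  assert (b := phi_bounds); assert (q := phi_sqr).
  (* The endpoints become [2 - phi] and [5 / 2 - phi], linear in [phi]. *)
  rewrite sqrt5_phi.
  split; intros n hn; assert (f0 := frac_part_phi_pos n hn);
    assert (f1 := proj2 (base_fp (INR n * phi))).
  - split; intros hf.
    + rewrite frac_part_d_phi_high by assumption; nra.
    + rewrite frac_part_d_phi_low by (split; assumption); nra.
  - split.
    + rewrite frac_part_c_even_phi; nra.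
    (* The images of the two ranges of [f] lie in [(phi - 1, 5 / 2 - phi)] and
       [(1 / 2, phi - 1)]. *)
    + destruct (Rlt_le_dec (frac_part (INR n * phi)) ((3 - phi) / 2)) as [h | h].
      * rewrite frac_part_c_odd_phi_low by assumption; nra.
      * rewrite frac_part_c_odd_phi_high by assumption.
        (* At [f = (3 - phi) / 2] the value would be exactly [1 / 2], so the strict lower bound
           needs this exclusion. *)
        assert (h' := frac_part_phi_neq n).
        assert ((3 - phi) / 2 < frac_part (INR n * phi)) by lra.
        nra.
Qed.
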